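(* Let $n\geqslant 1$, let $T$ be a maximal torus of $Sp_{2n}(\Bbbk)$ and $N(T)$ its normalizer in $Sp_{2n}(\Bbbk)$. Encode the connected components of $N(T)$ by pairs $(\sigma,\theta)$ with $\sigma\in S_n$, $\theta=(\varepsilon_1,\ldots,\varepsilon_n)\in\{\pm1\}^n$. Let $\sigma=(i_{1,1},\ldots,i_{1,s_1})\cdots(i_{k,1},\ldots,i_{k,s_k})$ be the decomposition of $\sigma$ into a product of independent cycles (cycles of length $1$ included). Then the component corresponding to $(\sigma,\theta)$ is periodic if and only if $$\prod_{q=1}^{s_j}\varepsilon_{i_{j,q}}=-1\quad\text{for all } j=1,\ldots,k,$$ and in this case every element of the component has order $4\cdot\operatorname{lcm}(s_1,\ldots,s_k)$.
   Context: $\Bbbk$ is an algebraically closed field of characteristic zero. A connected component of an affine algebraic group is called periodic if all its elements have finite order. Realize $Sp_{2n}(\Bbbk)=\{g\in GL_{2n}(\Bbbk)\mid g^T\Lambda g=\Lambda\}$, where $\Lambda=\begin{pmatrix}0&I\\-I&0\end{pmatrix}$ and $I$ is the $n\times n$ matrix with ones on the secondary diagonal and zeros elsewhere, and let $T=\{\operatorname{diag}(t_1,\ldots,t_n,t_n^{-1},\ldots,t_1^{-1})\mid t_i\in\Bbbk^*\}$, with characters $\chi_j(t)=t_j$, $j=1,\ldots,n$. For $g\in N(T)$ the automorphism $t\mapsto gtg^{-1}$ of $T$ induces an automorphism $A_g$ of the character lattice, $(A_g\lambda)(t)=\lambda(gtg^{-1})$, whose matrix in the basis $\chi_1,\ldots,\chi_n$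 is a monomial $(0,1,-1)$-matrix. The component $gT$ corresponds to the pair $(\sigma,\theta)$ determined by $A_g\chi_j=\varepsilon_j\chi_{\sigma(j)}$ for $j=1,\ldots,n$; all pairs in $S_n\times\{\pm1\}^n$ arise, each from exactly one component. *)

(* Defs.v *)
From mathcomp Require Import all_boot all_order all_fingroup all_algebra.
From mathcomp Require Import mpoly.

Set Implicit Arguments.
Unset Strict Implicit.
Unset Printing Implicit Defensive.

Import GRing.Theory.
Local Open Scope ring_scope.

Section ZariskiTopology.
Variables (k : fieldType) (m : nat).

(* The affine space of m x m matrices has the m * m entries, listed by mxvec, *)
(* as coordinates.                                                            *)
Definition zariski_closed (X : 'M[k]_m -> Prop) : Prop :=
  exists S : {mpoly k[m * m]} -> Prop,
    forall A, X A <-> (forall p, S p -> p.@[fun i => mxvec A 0 i] = 0).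

(* Connectedness for the topology induced on X.  The topology of a linear     *)
(* algebraic group is the one induced from the space of all matrices, as      *)
(* inverting the determinant only restricts to a principal open subset.       *)
Definition zariski_connected (X : 'M[k]_m -> Prop) : Prop :=
  (exists A, X A) /\
  forall Y Z, zariski_closed Y -> zariski_closed Z ->
    (forall A, X A -> Y A \/ Z A) ->
    (forall A, X A -> ~ (Y A /\ Z A)) ->
    (forall A, X A -> Y A) \/ (forall A, X A -> Z A).

Definition connected_component (G C : 'M[k]_m -> Prop) : Prop :=
  [/\ forall A, C A -> G A,
      zariski_connected C
    & forall D, (forall A, D A -> G A) -> zariski_connected D ->
        (forall A, C A -> D A) -> forall A, D A -> C A].

End ZariskiTopology.

Section MatrixOrder.
Variables (k : fieldType) (m : nat).

Definition finite_order (g : 'M[k]_m) : Prop :=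
  exists2 d, (0 < d)%N & g ^+ d = 1.

Definition has_order (g : 'M[k]_m) (d : nat) : Prop :=
  [/\ (0 < d)%N, g ^+ d = 1 & forall e, (0 < e < d)%N -> g ^+ e <> 1].

Definition periodic (C : 'M[k]_m -> Prop) : Prop :=
  forall g, C g -> finite_order g.

End MatrixOrder.

Section Symplectic.
Variables (k : fieldType) (n : nat).

Definition antidiag_mx : 'M[k]_n := \matrix_(i, j) (j == rev_ord i)%:R.

Definition symp_form : 'M[k]_(n + n) :=
  block_mx 0 antidiag_mx (- antidiag_mx) 0.

Definition Sp (g : 'M[k]_(n + n)) : Prop :=
  g \in unitmx /\ g^T *m symp_form *m g = symp_form.

Definition torus (A : 'M[k]_(n + n)) : Prop :=
  exists2 t : 'I_n -> k, (forall i, t i != 0)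
    & A = diag_mx (row_mx (\row_i t i) (\row_i (t (rev_ord i))^-1)).

Definition torus_normalizer (g : 'M[k]_(n + n)) : Prop :=
  Sp g /\ (forall t, torus (g *m t *m invmx g) <-> torus t).

(* Characters are represented by functions on all matrices, of which only the *)
(* values on the torus matter.                                                *)
Definition chi (j : 'I_n) (t : 'M[k]_(n + n)) : k := t (lshift n j) (lshift n j).

Definition char_act (g : 'M[k]_(n + n)) (lambda : 'M[k]_(n + n) -> k)
  (t : 'M[k]_(n + n)) : k := lambda (g *m t *m invmx g).

(* The character lattice is written additively in A_g chi_j = eps_j chi_(s j),*)
(* hence the exponent here.  All elements of a component of the normalizer    *)
(* induce the same automorphism, so any one of them determines the pair.      *)
Definition corresponds (C : 'M[k]_(n + n) -> Prop)
    (s : 'S_n) (eps : 'I_n -> int) : Prop :=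
  exists2 g, C g & forall j t, torus t ->
    char_act g (chi j) t = chi (s j) t ^ eps j.

End Symplectic.

Arguments torus_normalizer : clear implicits.

(* Main.v *)
(** Conjugating a regular torus element shows that N(T) consists of the monomial
    matrices g with g i (p i) = w i, where the permutation p commutes with the
    reversal i |-> rev i of the 2n indices and w i * w (rev i) = sgn i * sgn (p i).
    For fixed p these matrices are closed and open in N(T), and any two of them are
    joined by a rational curve, so they form one component.  Its pair (sigma, eps)
    says that p maps j to sigma j or to rev (sigma j) according to the sign eps j.
    Over a cycle of length N with sign product -1, p^N acts as rev, so the 2N
    weights of the orbit pair up into the symplectic relation and g^(2N) acts by
    -1: the order there is 4N.  If the product is +1, the p-orbit avoids rev x, and
    rescaling a single weight gives an element of infinite order. *)

Require Import Defs.
From mathcomp Require Import all_boot all_order all_fingroup all_algebra.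
From mathcomp Require Import mpoly zify ring.
From Stdlib Require Import Classical.

Set Implicit Arguments.
Unset Strict Implicit.
Unset Printing Implicit Defensive.

Import GRing.Theory.
Local Open Scope ring_scope.

(** * Connectedness along rational curves *)

Section RationalCurves.
Variable k : fieldType.
Hypothesis char0 : [pchar k] =i pred0.

Lemma pchar0_natr_inj : injective (fun i => i%:R : k).
Proof.
move=> i j /eqP; wlog le_ij : i j / (i <= j)%N => [hw|].
  by case/orP: (leq_total i j) => ij E; [|rewrite eq_sym in E; apply/esym]; apply: hw.
rewrite eq_sym -subr_eq0 -natrB // (pcharf0P _).1 // subn_eq0 => le_ji.
by apply/eqP; rewrite eqn_leq le_ij.
Qed.

Lemma pchar0_expr2_inj : injective (fun i => 2%:R ^+ i : k).
Proof.
move=> i j /=; rewrite -!natrX => /pchar0_natr_inj /eqP.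
by rewrite eqn_exp2l // => /eqP.
Qed.

Lemma pchar0_poly_eq0 (p : {poly k}) : (forall c, p.[c] = 0) -> p = 0.
Proof.
move=> p0; apply/eqP/negPn/negP => nzp.
pose rs : seq k := [seq i%:R | i <- iota 0 (size p)].
have := @max_poly_roots _ p rs nzp.
rewrite size_map size_iota ltnn => H; suff: false by [].
apply: H; first by apply/allP => x _; rewrite /root p0.
by rewrite map_inj_uniq ?iota_uniq //; apply: pchar0_natr_inj.
Qed.

(** Membership in the localization of [{poly k}] at [d], expressed through values; nothing is asked
    at the zeros of [d], where a curve may have poles. *)
Definition regular_away (d : {poly k}) (f : k -> k) : Prop :=
  exists N (a : {poly k}), forall c, d.[c] != 0 -> f c * d.[c] ^+ N = a.[c].

Lemma regular_cst d a : regular_away d (fun=> a).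
Proof. by exists 0%N, a%:P => c _; rewrite mulr1 hornerC. Qed.

Lemma regularD d f g : regular_away d f -> regular_away d g ->
  regular_away d (fun c => f c + g c).
Proof.
move=> [N [a fa]] [M [b gb]]; exists (N + M)%N, (a * d ^+ M + b * d ^+ N) => c nz.
by rewrite !hornerE -(fa c nz) -(gb c nz) exprD; ring.
Qed.

Lemma regularM d f g : regular_away d f -> regular_away d g ->
  regular_away d (fun c => f c * g c).
Proof.
move=> [N [a fa]] [M [b gb]]; exists (N + M)%N, (a * b) => c nz.
by rewrite !hornerE -(fa c nz) -(gb c nz) exprD; ring.
Qed.

Lemma eq_regular d f g : f =1 g -> regular_away d f -> regular_away d g.
Proof. by move=> fg [N [a fa]]; exists N, a => c nz; rewrite -fg fa. Qed.

Lemma regular_prod I (r : seq I) d (f : I -> k -> k) :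
  (forall i, regular_away d (f i)) -> regular_away d (fun c => \prod_(i <- r) f i c).
Proof.
move=> rf; elim: r => [|i r IH].
  by apply: eq_regular (regular_cst d 1) => c; rewrite big_nil.
by apply: eq_regular (regularM (rf i) IH) => c; rewrite big_cons.
Qed.

Lemma regular_meval n d (p : {mpoly k[n]}) (v : 'I_n -> k -> k) :
  (forall i, regular_away d (v i)) -> regular_away d (fun c => p.@[fun i => v i c]).
Proof.
move=> rv; elim/mpolyind: p => [|a m p _ _ IH].
  by apply: eq_regular (regular_cst d 0) => c; rewrite meval0.
pose mon c := \prod_(i < n) \prod_(j <- iota 0 (m i)) v i c.
have rmon : regular_away d mon by apply: regular_prod => i; apply: regular_prod.
apply: eq_regular (regularD (regularM (regular_cst d a) rmon) IH) => c.
rewrite mevalD mevalZ mevalX; congr (_ * _ + _); apply: eq_bigr => i _.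
by rewrite big_const_seq count_predT size_iota iter_mulr_1.
Qed.

(* Two points separated by a clopen partition give two functions on the curve,
   each vanishing where the other need not, whose product is zero. *)
Lemma rational_path_connected m (X : 'M[k]_m -> Prop) :
  (exists A, X A) ->
  (forall A B, X A -> X B -> exists (d : {poly k}) (M : k -> 'M[k]_m),
     [/\ forall i j, regular_away d (fun c => M c i j),
         forall c, d.[c] != 0 -> X (M c) &
         [/\ d.[0] != 0, d.[1] != 0, M 0 = A & M 1 = B]]) ->
  zariski_connected X.
Proof.
move=> neX path; split=> // Y Z [S YE] [U ZE] cov disj.
have [[A XA nYA]|YX] := classic (exists2 A, X A & ~ Y A); last first.
  by left=> A XA; have [//|nY] := classic (Y A); case: YX; exists A.
have [[B XB nZB]|ZX] := classic (exists2 B, X B & ~ Z B); last first.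
  by right=> B XB; have [//|nZ] := classic (Z B); case: ZX; exists B.
exfalso.
have [p Sp pA] : exists2 p, S p & p.@[fun i => mxvec A 0 i] != 0.
  apply: NNPP => H; case: nYA; apply/YE => p Sp; apply/eqP.
  by apply: contraT => nz; case: H; exists p.
have [q Uq qB] : exists2 q, U q & q.@[fun i => mxvec B 0 i] != 0.
  apply: NNPP => H; case: nZB; apply/ZE => q Uq; apply/eqP.
  by apply: contraT => nz; case: H; exists q.
have [d [M [regM XM [d0 d1 M0 M1]]]] := path A B XA XB.
have regv i : regular_away d (fun c => mxvec (M c) 0 i).
  by case/mxvec_indexP: i => i j; apply: eq_regular (regM i j) => c; rewrite mxvecE.
have [N [a pa]] := regular_meval p regv.
have [N' [b qb]] := regular_meval q regv.
have nzd : d != 0 by apply: contraNneq d0 => ->; rewrite horner0.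
(* The factor [d] covers the parameters where the curve is not controlled, so the product vanishes
   on all of [k]. *)
have : a * b * d = 0.
  apply: pchar0_poly_eq0 => c; rewrite !hornerE.
  have [->|dc] := eqVneq d.[c] 0; first by rewrite mulr0.
  rewrite -pa // -qb //.
  have [/YE /(_ p Sp) ->|/ZE /(_ q Uq) ->] := cov _ (XM c dc); by rewrite ?(mul0r, mulr0).
move/eqP; rewrite !mulf_eq0 (negPf nzd) orbF => /orP [] /eqP E.
  move: (pa 0 d0); rewrite E horner0 M0 => /eqP.
  by rewrite mulf_eq0 (negPf pA) expf_eq0 (negPf d0) andbF.
move: (qb 1 d1); rewrite E horner0 M1 => /eqP.
by rewrite mulf_eq0 (negPf qB) expf_eq0 (negPf d1) andbF.
Qed.

End RationalCurves.

(** * Algebra of monomial matrices *)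

Section MonomialMatrices.
Variables (k : fieldType) (m : nat).
Implicit Types (p q : 'S_m) (w v : 'I_m -> k).

(** Sending rows to columns makes matrix products follow the left-to-right composition of
    permutations. *)
Definition mono p w : 'M[k]_m := \matrix_(i, j) (w i *+ (j == p i)).

Lemma mono_diag p w i : mono p w i (p i) = w i.
Proof. by rewrite mxE eqxx. Qed.

Lemma eq_mono p w v : w =1 v -> mono p w = mono p v.
Proof. by move=> wv; apply/matrixP => i j; rewrite !mxE wv. Qed.

Lemma mono_inj p q w v : (forall i, w i != 0) -> mono p w = mono q v ->
  p = q /\ w =1 v.
Proof.
move=> nzw /matrixP E.
have pq : p = q.
  apply/permP => i; have := E i (p i); rewrite !mxE eqxx.
  by case: eqP => // _ /eqP; rewrite mulr1n (negPf (nzw i)).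
by split=> // i; have := E i (p i); rewrite mono_diag pq mono_diag.
Qed.

Lemma mul_mono p q w v :
  mono p w *m mono q v = mono (p * q)%g (fun i => w i * v (p i)).
Proof.
apply/matrixP => i j; rewrite !mxE (bigD1 (p i)) //= !mxE eqxx big1 => [|l lp].
  by rewrite addr0 permM -mulrnAr.
by rewrite !mxE (negPf lp) mulr0n mul0r.
Qed.

Lemma mono1 : mono 1%g (fun=> 1) = 1%:M.
Proof. by apply/matrixP => i j; rewrite !mxE perm1 eq_sym. Qed.

Lemma mono_exp p w d :
  mono p w ^+ d = mono (p ^+ d)%g (fun i => \prod_(q < d) w ((p ^+ q)%g i)).
Proof.
elim: d => [|d IH].
  by rewrite expr0 expg0 -[1]mono1; apply: eq_mono => i; rewrite big_ord0.
rewrite exprSr IH [_ * _]mul_mono -expgSr; apply: eq_mono => i.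
by rewrite big_ord_recr.
Qed.

Lemma trmx_mono p w :
  (mono p w)^T = mono p^-1%g (fun i => w (p^-1%g i)).
Proof.
apply/matrixP => i j; rewrite !mxE [j == _]eq_sym (canF_eq (permKV p)).
by case: eqP => // ->; rewrite permK.
Qed.

Lemma diag_mono u : diag_mx u = mono 1%g (u 0).
Proof. by apply/matrixP => i j; rewrite !mxE perm1 eq_sym. Qed.

Lemma unit_mono p w : (forall i, w i != 0) -> mono p w \in unitmx.
Proof.
move=> nzw; have E : mono p w *m mono p^-1%g (fun i => (w (p^-1%g i))^-1) = 1%:M.
  by rewrite mul_mono -mono1 mulgV; apply: eq_mono => i; rewrite permK divff.
by have [] := mulmx1_unit E.
Qed.

(** The weights cancel, so all matrices with the same [p] act alike on diagonal matrices. *)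
Lemma mono_conj p w u : (forall i, w i != 0) ->
  mono p w *m diag_mx u *m invmx (mono p w) = diag_mx (\row_i u 0 (p i)).
Proof.
move=> nzw; rewrite -[RHS](mulmxK (unit_mono p nzw)); congr (_ *m _).
by rewrite !diag_mono !mul_mono mulg1 mul1g; apply: eq_mono => i;
  rewrite !mxE perm1 mulrC.
Qed.

(* Comparing entries in g diag(u) = diag(u') g, the regularity of u leaves one
   nonzero entry in each row, and invertibility makes its position a bijection. *)
Lemma normalizes_regular_mono (g : 'M[k]_m) (u u' : 'rV[k]_m) :
  injective (u 0) -> g \in unitmx -> g *m diag_mx u *m invmx g = diag_mx u' ->
  exists p w, (forall i, w i != 0) /\ g = mono p w.
Proof.
move=> injU ug E.
have gE : g *m diag_mx u = diag_mx u' *m g by rewrite -E mulmxKV.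
have nz_u i j : g i j != 0 -> u 0 j = u' 0 i.
  move=> gij; move/matrixP/(_ i j): gE.
  by rewrite mul_diag_mx mul_mx_diag !mxE mulrC => /(mulIf gij).
have row_nz i : exists j, g i j != 0.
  apply/existsP; apply: contraT; rewrite negb_exists => /forallP H.
  have := congr1 (fun A : 'M_m => A i i) (mulmxV ug); rewrite !mxE eqxx big1.
    by move/eqP; rewrite eq_sym oner_eq0.
  by move=> j _; have /negPn/eqP -> := H j; rewrite mul0r.
have col_nz j : exists i, g i j != 0.
  apply/existsP; apply: contraT; rewrite negb_exists => /forallP H.
  have := congr1 (fun A : 'M_m => A j j) (mulVmx ug); rewrite !mxE eqxx big1.
    by move/eqP; rewrite eq_sym oner_eq0.
  by move=> i _; have /negPn/eqP -> := H i; rewrite mulr0.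
pose f i := xchoose (row_nz i); pose h j := xchoose (col_nz j).
have fP i : g i (f i) != 0 by apply: (xchooseP (row_nz i)).
have f_uniq i j : g i j != 0 -> j = f i.
  by move=> gij; apply: injU; rewrite (nz_u i j) // (nz_u i (f i)).
have hK : cancel h f.
  by move=> j; apply/esym/f_uniq; apply: (xchooseP (col_nz j)).
(* An injective self-map of a finite set is bijective, so the right inverse [h] of [f] is
   two-sided. *)
have injf : injective f.
  have [h' _ h'K] := injF_bij (can_inj hK).
  by apply: can_inj (h) _ => x; rewrite -[x]h'K hK.
exists (perm injf), (fun i => g i (f i)); split=> //.
apply/matrixP => i j; rewrite !mxE permE.
by case: eqP => [->//|ne]; apply/eqP/negPn/negP => /f_uniq.
Qed.

End MonomialMatrices.

(** * The normalizer of the torus and its components *)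

Section SymplecticNormalizer.
Variables (k : fieldType) (n : nat).
Implicit Types (p : 'S_(n + n)) (w : 'I_(n + n) -> k).

Lemma rev_lshift (j : 'I_n) : rev_ord (lshift n j) = rshift n (rev_ord j).
Proof. by apply: val_inj => /=; have := ltn_ord j; lia. Qed.

Lemma rev_rshift (j : 'I_n) : rev_ord (rshift n j) = lshift n (rev_ord j).
Proof. by apply: val_inj => /=; have := ltn_ord j; lia. Qed.

Lemma rev_ord_neq (i : 'I_(n + n)) : rev_ord i != i.
Proof. by apply/eqP => /(congr1 val) /=; have := ltn_ord i; lia. Qed.

Definition rev_perm : 'S_(n + n) := perm (@rev_ord_inj (n + n)).

Lemma rev_permE i : rev_perm i = rev_ord i.
Proof. exact: permE. Qed.

Definition sgn (i : 'I_(n + n)) : k := if (i < n)%N then 1 else -1.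

Lemma sgn_lshift j : sgn (lshift n j) = 1.
Proof. by rewrite /sgn /= ltn_ord. Qed.

Lemma sgn_rshift j : sgn (rshift n j) = -1.
Proof. by rewrite /sgn /= ltnNge leq_addr. Qed.

Lemma sgn_rev i : sgn (rev_ord i) = - sgn i.
Proof.
case: (split_ordP i) => j ->; first by rewrite rev_lshift sgn_lshift sgn_rshift.
by rewrite rev_rshift sgn_lshift sgn_rshift opprK.
Qed.

Lemma sgnM i : sgn i * sgn i = 1.
Proof. by rewrite /sgn; case: ifP; rewrite ?mulrNN mulr1. Qed.

Lemma sgn_neq0 i : sgn i != 0.
Proof. by apply/eqP => s0; have /eqP := sgnM i; rewrite s0 mulr0 eq_sym oner_eq0. Qed.

Lemma symp_formE : symp_form k n = mono rev_perm sgn.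
Proof.
apply/matrixP => i j; rewrite [RHS]mxE permE.
case: (split_ordP i) => i' ->; case: (split_ordP j) => j' ->.
- by rewrite block_mxEul mxE rev_lshift eq_lrshift.
- by rewrite block_mxEur mxE rev_lshift eq_rshift sgn_lshift.
- by rewrite block_mxEdl !mxE rev_rshift eq_lshift sgn_rshift mulNrn.
- by rewrite block_mxEdr mxE rev_rshift eq_rlshift.
Qed.

Lemma torusE (A : 'M[k]_(n + n)) : torus A <->
  exists2 u : 'rV_(n + n), (forall i, u 0 i * u 0 (rev_ord i) = 1) & A = diag_mx u.
Proof.
split=> [[t nzt ->]|[u uu ->]].
  exists (row_mx (\row_i t i) (\row_i (t (rev_ord i))^-1)) => // i.
  case: (split_ordP i) => j ->.
    by rewrite rev_lshift row_mxEl row_mxEr !mxE rev_ordK divff.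
  by rewrite rev_rshift row_mxEl row_mxEr !mxE mulVf.
have nzu i : u 0 i != 0.
  by apply/eqP => u0; have /eqP := uu i; rewrite u0 mul0r eq_sym oner_eq0.
exists (fun j => u 0 (lshift n j)) => //; congr diag_mx.
apply/rowP => i; case: (split_ordP i) => j ->; rewrite ?row_mxEl ?row_mxEr mxE //.
by rewrite -rev_rshift -[RHS]mul1r -(uu (rshift n j)) mulfK.
Qed.

Lemma chi_diag j (u : 'rV[k]_(n + n)) : chi j (diag_mx u) = u 0 (lshift n j).
Proof. by rewrite /chi mxE eqxx. Qed.

Lemma regular_torus : [pchar k] =i pred0 -> exists2 u : 'rV[k]_(n + n),
  (forall i, u 0 i * u 0 (rev_ord i) = 1) & injective (u 0).
Proof.
move=> char0; have nz2 : (2%:R : k) != 0 by rewrite (pcharf0P _).1.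
(* The exponent of 2 at [i] is [2i - (2n - 1)]: it changes sign under reversal and increases
   strictly with [i]. *)
pose u : 'rV[k]_(n + n) := \row_i (2%:R ^+ i / 2%:R ^+ rev_ord i).
have uu i : u 0 i * u 0 (rev_ord i) = 1.
  by rewrite !mxE rev_ordK mulf_div [X in _ / X]mulrC divff // mulf_neq0 ?expf_neq0.
exists u => // i j; rewrite !mxE => /eqP.
rewrite eqr_div ?expf_neq0 // -!exprD => /eqP /(pchar0_expr2_inj char0) E.
apply: val_inj => /=; move: E => /=; have := ltn_ord i; have := ltn_ord j; lia.
Qed.

Definition rev_equivariant p := forall i, p (rev_ord i) = rev_ord (p i).

Definition symp_weight p w := forall i, w i * w (rev_ord i) = sgn i * sgn (p i).

Lemma symp_weight_neq0 p w i : symp_weight p w -> w i != 0.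
Proof.
move=> sw; apply/eqP => w0; have /eqP := sw i.
by rewrite w0 mul0r eq_sym mulf_eq0 !(negPf (sgn_neq0 _)).
Qed.

(** The form is itself monomial, so its invariance is an equality of monomial matrices: the
    permutations give equivariance, the weights give the relation. *)
Lemma Sp_monoP p w : (forall i, w i != 0) ->
  Sp (mono p w) <-> rev_equivariant p /\ symp_weight p w.
Proof.
move=> nzw; rewrite /Sp symp_formE trmx_mono !mul_mono unit_mono //.
split=> [[_ /esym E]|[rp sw]].
  have [pE wE] := mono_inj sgn_neq0 E; split=> i.
    have := congr1 (fun q : 'S_(n + n) => q (p i)) pE.
    by rewrite !permM permK !rev_permE.
  have := wE (p i); rewrite !permM permK rev_permE => ->.
  by rewrite -[LHS]mul1r -(sgnM i); ring.
split=> //; rewrite (_ : (_ * _ * _)%g = rev_perm); last first.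
  by apply/permP => i; rewrite !permM !rev_permE rp permKV.
apply: eq_mono => i; rewrite permM rev_permE mulrAC sw permKV.
by rewrite mulrAC sgnM mul1r.
Qed.

Lemma torus_normalizerP (char0 : [pchar k] =i pred0) (g : 'M[k]_(n + n)) :
  torus_normalizer k n g <->
  exists p w, [/\ rev_equivariant p, symp_weight p w & g = mono p w].
Proof.
split=> [[Spg gT]|[p [w [rp sw ->]]]].
  have [u uu injU] := regular_torus char0.
  have /torusE [u' _ E] : torus (g *m diag_mx u *m invmx g).
    by apply/gT/torusE; exists u.
  have [p [w [nzw gE]]] := normalizes_regular_mono injU (proj1 Spg) E.
  by exists p, w; move: Spg; rewrite gE => /Sp_monoP [].
have nzw i := symp_weight_neq0 i sw.
split=> [|t]; first exact/Sp_monoP.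
split=> /torusE [u uu tE]; apply/torusE.
  exists (\row_i u 0 (p^-1%g i)) => [i|].
    rewrite !mxE -[RHS](uu (p^-1%g i)); congr (_ * u 0 _).
    by apply: (@perm_inj _ p); rewrite rp !permKV.
  have ug := unit_mono p nzw.
  rewrite -[t](mulKmx ug) -[_ *m t](mulmxKV ug) tE; apply: (canLR (mulKmx ug)).
  rewrite !diag_mono !mul_mono mulg1 mul1g; apply: eq_mono => i.
  by rewrite !mxE perm1 permK mulrC.
exists (\row_i u 0 (p i)) => [i|]; first by rewrite !mxE rp uu.
by rewrite tE mono_conj.
Qed.

Definition mono_class p (g : 'M[k]_(n + n)) : Prop :=
  exists2 w, symp_weight p w & g = mono p w.

Hypothesis char0 : [pchar k] =i pred0.

(** The relation pairs each weight of the first half with one of the second. Between two members,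
    the first half moves along lines while the partners move by the inverse factors. *)
Lemma mono_class_connected p w : symp_weight p w -> zariski_connected (mono_class p).
Proof.
move=> sw; apply: rational_path_connected => //.
  by exists (mono p w), w.
move=> _ _ [{sw}w sw ->] [v sv ->].
have nzw i := symp_weight_neq0 i sw.
have nzv i := symp_weight_neq0 i sv.
pose l (i : 'I_(n + n)) : {poly k} :=
  if (i < n)%N then 1 + (v i / w i - 1)%:P * 'X else 1.
have l0 i : (l i).[0] = 1 by rewrite /l; case: ifP; rewrite !hornerE.
have l1 i : (l i).[1] = if (i < n)%N then v i / w i else 1.
  by rewrite /l; case: ifP => _; rewrite !hornerE //=; ring.
pose d := \prod_i l i.
pose x c i := w i * (l i).[c] / (l (rev_ord i)).[c].
have nzl c i : d.[c] != 0 -> (l i).[c] != 0.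
  by rewrite horner_prod => /prodf_neq0 /(_ i isT).
exists d, (fun c => mono p (x c)); split.
- move=> i j; pose f c := (w i *+ (j == p i)) * ((l i).[c] * (l (rev_ord i)).[c]^-1).
  apply: (@eq_regular _ _ f); first by move=> c; rewrite mxE /x /f -mulrA mulrnAl.
  apply: regularM; first exact: regular_cst.
  apply: regularM; first by exists 0%N, (l i) => c _; rewrite mulr1.
  exists 1%N, (\prod_(j | j != rev_ord i) l j) => c dc.
  by rewrite expr1 /d (bigD1 (rev_ord i)) //= hornerM mulKf // nzl.
- move=> c dc; exists (x c) => // i; rewrite -(sw i) /x rev_ordK.
  by field; rewrite !nzl.
split.
- by rewrite horner_prod big1 ?oner_eq0 // => i _; rewrite l0.
- rewrite horner_prod; apply/prodf_neq0 => i _; rewrite l1.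
  by case: ifP => _; rewrite ?oner_eq0 // mulf_neq0 ?invr_eq0.
- by apply: eq_mono => i; rewrite /x !l0 mulr1 divr1.
apply: eq_mono => i; rewrite /x !l1.
(* On the second half the endpoint is forced, since [w] and [v] have equal products over reversed
   pairs. *)
have wv : w i * w (rev_ord i) = v i * v (rev_ord i) by rewrite sw sv.
have -> : (rev_ord i < n)%N = ~~ (i < n)%N by case: i {wv} => i /=; lia.
case: (i < n)%N => /=; first by rewrite divr1 mulrC divfK.
by rewrite mulr1 invf_div mulrA wv mulfK.
Qed.

(* On N(T) the pattern of p is both closed, by vanishing of the other entries,
   and open, its complement being the zero locus of the product of its entries. *)
Lemma connected_sub_mono_class p (C : 'M[k]_(n + n) -> Prop) :
  (forall g, C g -> torus_normalizer k n g) -> zariski_connected C ->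
  (exists2 g, C g & mono_class p g) -> forall g, C g -> mono_class p g.
Proof.
move=> CN [_ conn] [g0 Cg0 [w0 sw0 g0E]].
pose Y (A : 'M[k]_(n + n)) := forall i j, j != p i -> A i j = 0.
pose Z (A : 'M[k]_(n + n)) := \prod_i A i (p i) = 0.
have clY : zariski_closed Y.
  exists (fun P => exists i j, j != p i /\ P = 'X_(mxvec_index i j)) => A.
  split=> [YA P [i [j [ij ->]]]|H i j ij]; first by rewrite mevalXU mxvecE YA.
  by rewrite -(mxvecE A i j) -mevalXU; apply: H; exists i, j.
have clZ : zariski_closed Z.
  exists (fun P => P = \prod_i 'X_(mxvec_index i (p i))) => A.
  have E : (\prod_i 'X_(mxvec_index i (p i))).@[fun i => mxvec A 0 i] =
      \prod_i A i (p i).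
    by rewrite rmorph_prod; apply: eq_bigr => i _; rewrite /= mevalXU mxvecE.
  by split=> [ZA P ->|H]; [rewrite E | rewrite /Z -E; apply: H].
have YZ A : C A -> Y A \/ Z A.
  move=> /CN /(torus_normalizerP char0) [q [w [_ sw ->]]].
  have [pq|qp] := eqVneq p q; first by left=> i j /negPf ij; rewrite mxE -pq ij.
  right; have [i piq] : exists i, p i != q i.
    apply/existsP; apply: contraNT qp; rewrite negb_exists => /forallP H.
    by apply/eqP/permP => i; apply/eqP/negPn/H.
  by rewrite /Z (bigD1 i) //= mxE (negPf piq) mul0r.
(* [Y] forces the permutation of [A] to be [p]; the product in [Z] is then one of nonzero
   weights. *)
have nYZ A : C A -> ~ (Y A /\ Z A).
  move=> /CN /(torus_normalizerP char0) [q [w [_ sw ->]]] [YA /eqP ZA].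
  have qp i : q i = p i.
    apply/eqP; apply: contraT => /YA /eqP.
    by rewrite mono_diag (negPf (symp_weight_neq0 i sw)).
  move: ZA; apply/negP; apply/prodf_neq0 => i _.
  by rewrite -qp mono_diag (symp_weight_neq0 i sw).
have [CY|CZ] := conn Y Z clY clZ YZ nYZ.
  move=> A CA; have YA := CY A CA.
  have /(torus_normalizerP char0) [q [w [_ sw AE]]] := CN A CA.
  have qp : q = p.
    apply/permP => i; apply/eqP; apply: contraT => /YA /eqP.
    by rewrite AE mono_diag (negPf (symp_weight_neq0 i sw)).
  by exists w; rewrite -qp.
have /eqP := CZ g0 Cg0; rewrite g0E => /prodf_eq0 [i _].
by rewrite mono_diag (negPf (symp_weight_neq0 i sw0)).
Qed.

(** One inclusion holds because the class is clopen in N(T), the other by maximality of [C], the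
    class being connected. *)
Lemma connected_component_mono (C : 'M[k]_(n + n) -> Prop) g :
  connected_component (torus_normalizer k n) C -> C g ->
  exists p w, [/\ rev_equivariant p, symp_weight p w, g = mono p w &
    forall h, C h <-> mono_class p h].
Proof.
move=> [CN conn maxC] Cg.
have /(torus_normalizerP char0) [p [w [rp sw gE]]] := CN g Cg.
have sub : forall h, C h -> mono_class p h.
  by apply: connected_sub_mono_class => //; exists g => //; exists w.
exists p, w; split=> // h; split; first exact: sub.
apply: maxC => //; last exact: mono_class_connected sw.
by move=> A [v sv ->]; apply/(torus_normalizerP char0); exists p, v.
Qed.

(** Evaluation at a torus element with distinct entries turns equality of characters into equality
    of indices; inverting an entry amounts to reversing its index. *)
Lemma char_act_mono p w (s : 'S_n) (eps : 'I_n -> int) :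
  (forall i, eps i = 1 \/ eps i = -1) -> (forall i, w i != 0) ->
  (forall j t, torus t -> char_act (mono p w) (chi j) t = chi (s j) t ^ eps j) ->
  forall j, p (lshift n j) =
    if eps j == 1 then lshift n (s j) else rev_ord (lshift n (s j)).
Proof.
move=> eps1 nzw act j; have [u uu injU] := regular_torus char0.
have tu : torus (diag_mx u) by apply/torusE; exists u.
have := act j _ tu; rewrite /char_act mono_conj // !chi_diag mxE.
case: (eps1 j) => ->; first by rewrite eqxx expr1z => /injU.
rewrite /= exprN1 => E; apply: injU; rewrite E -[LHS]mulr1 -(uu (lshift n (s j))).
apply: mulKf; apply/eqP => u0; have /eqP := uu (lshift n (s j)).
by rewrite u0 mul0r eq_sym oner_eq0.
Qed.

End SymplecticNormalizer.

(** * Cycles of a permutation *)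

Section OrbitLength.
Variables (T : finType) (s : {perm T}).

(** The iterates of [x] along one turn of its cycle are distinct, so the remainder of [d] modulo the
    length, whose power also fixes [x], is zero. *)
Lemma perm_fix_dvd_porbit d x : ((s ^+ d)%g x = x) -> (#|porbit s x| %| d)%N.
Proof.
have := iter_porbit s x; rewrite -permX; set N := #|porbit s x| => sN1 sd.
have sN a : (s ^+ (a * N))%g x = x.
  elim: a => [|a IH]; first by rewrite mul0n expg0 perm1.
  by rewrite mulSn expgD permM sN1.
have Ngt0 : (0 < N)%N by apply/card_gt0P; exists x; apply: porbit_id.
have ltr : (d %% N < N)%N by rewrite ltn_mod.
move: sd; rewrite {1}(divn_eq d N) expgD permM sN permX => sr.
have := nth_uniq x _ _ (uniq_traject_porbit s x).
move=> /(_ (d %% N)%N 0%N); rewrite !size_traject !nth_traject // sr eqxx.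
by move=> /(_ ltr Ngt0) /esym.
Qed.

Lemma prod_porbit (R : comRingType) (F : T -> R) x :
  \prod_(q < #|porbit s x|) F ((s ^+ q)%g x) = \prod_(i in porbit s x) F i.
Proof.
rewrite (eq_bigl _ _ (porbit_traject s x)) -big_uniq ?uniq_traject_porbit //=.
rewrite (big_nth x) size_traject big_mkord; apply: eq_bigr => q _.
by rewrite nth_traject // permX.
Qed.

End OrbitLength.

(** * Powers and orders of monomial matrices *)

Section MonomialOrder.
Variables (k : fieldType) (n : nat).
Hypothesis char0 : [pchar k] =i pred0.
Variables (p : 'S_(n + n)) (s : 'S_n) (eps : 'I_n -> int).
Hypothesis rp : rev_equivariant p.
Hypothesis eps_sign : forall i, eps i = 1 \/ eps i = -1.
Hypothesis pE : forall j, p (lshift n j) =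
  if eps j == 1 then lshift n (s j) else rev_ord (lshift n (s j)).

Lemma rev_equivariantX d : rev_equivariant (p ^+ d)%g.
Proof.
by elim: d => [|d IH] i; rewrite ?expg0 ?perm1 // !expgSr !permM IH rp.
Qed.

Lemma prod_sign I (r : seq I) (P : pred I) (F : I -> 'I_n) :
  \prod_(i <- r | P i) eps (F i) = 1 \/ \prod_(i <- r | P i) eps (F i) = -1.
Proof.
elim/big_rec: _ => [|i x _ [] ->]; first by left.
  by rewrite mulr1.
by case: (eps_sign (F i)) => ->; [right | left].
Qed.

(** Each sign -1 reverses the index, and equivariance carries reversals outside, so only the
    accumulated product matters. *)
Lemma lshiftX d j : (p ^+ d)%g (lshift n j) =
  if \prod_(q < d) eps ((s ^+ q)%g j) == 1 then lshift n ((s ^+ d)%g j)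
  else rev_ord (lshift n ((s ^+ d)%g j)).
Proof.
elim: d => [|d IH]; first by rewrite big_ord0 eqxx !perm1.
rewrite !expgSr !permM IH big_ord_recr /=.
case: (prod_sign (index_enum 'I_d) xpredT (fun q : 'I_d => (s ^+ q)%g j)) => ->;
  case: (eps_sign ((s ^+ d)%g j)) => e; rewrite ?rp pE e //=.
by rewrite rev_ordK.
Qed.

(** Identifying each index with its reversal turns [p] into [s]. *)
Lemma lshiftX_fix d j :
  (p ^+ d)%g (lshift n j) = lshift n j \/ (p ^+ d)%g (lshift n j) = rev_ord (lshift n j) ->
  (s ^+ d)%g j = j.
Proof.
rewrite lshiftX; case: ifP => _ [] /eqP.
- by rewrite eq_lshift => /eqP.
- by rewrite rev_lshift eq_lrshift.
- by rewrite rev_lshift eq_rlshift.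
by rewrite (inj_eq rev_ord_inj) eq_lshift => /eqP.
Qed.

Lemma lshiftX_porbit j : (p ^+ #|porbit s j|)%g (lshift n j) =
  if \prod_(i in porbit s j) eps i == 1 then lshift n j else rev_ord (lshift n j).
Proof. by rewrite lshiftX prod_porbit permX iter_porbit. Qed.

Variable w : 'I_(n + n) -> k.
Hypothesis sw : symp_weight p w.

(** By [mono_exp], the nonzero entry in row [x] of [mono p w ^+ d]. *)
Definition weight d x := \prod_(q < d) w ((p ^+ q)%g x).

Lemma mono_exp_eq1 d : mono p w ^+ d = 1 <->
  forall x, (p ^+ d)%g x = x /\ weight d x = 1.
Proof.
rewrite mono_exp -[1 : 'M[k]_(n + n)]mono1; split=> [E x|H].
  have [<- vE] := mono_inj (fun=> oner_neq0 k) (esym E).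
  by rewrite perm1 /weight -vE.
have -> : (p ^+ d)%g = 1%g by apply/permP => x; rewrite perm1 (H x).1.
by apply: eq_mono => x; apply: (H x).2.
Qed.

Lemma weightD a b x : weight (a + b) x = weight a x * weight b ((p ^+ a)%g x).
Proof.
rewrite /weight big_split_ord /=; congr (_ * _).
by apply: eq_bigr => q _; rewrite expgD permM.
Qed.

(** The symplectic relations along the orbit telescope, the inner signs occurring squared. *)
Lemma weight_rev d x :
  weight d x * weight d (rev_ord x) = sgn k x * sgn k ((p ^+ d)%g x).
Proof.
elim: d => [|d IH]; first by rewrite /weight !big_ord0 perm1 sgnM mulr1.
rewrite -addn1 !weightD mulrACA IH /weight !big_ord1 !expg0 !perm1.
by rewrite rev_equivariantX sw expgD permM -mulrA [X in _ * X]mulrA sgnM mul1r.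
Qed.

Lemma weight_cycle N a x : (p ^+ N)%g x = x -> weight (a * N) x = weight N x ^+ a.
Proof.
move=> pN; elim: a => [|a IH]; first by rewrite mul0n /weight big_ord0.
by rewrite mulSn weightD pN IH exprS.
Qed.

Lemma revX N a x : (p ^+ N)%g x = rev_ord x ->
  (p ^+ (a * N))%g x = if odd a then rev_ord x else x.
Proof.
move=> pN; elim: a => [|a IH]; first by rewrite mul0n perm1.
rewrite mulSnr expgD permM IH /=; case: (odd a) => //=.
by rewrite rev_equivariantX pN rev_ordK.
Qed.

(* Along an orbit running through x and rev x, the 2N weights pair up into the
   symplectic relation, so g^(2N) acts by -1. *)
Lemma fix_rev_orbit N d x : (p ^+ N)%g x = rev_ord x -> (N %| d)%N ->
  ((p ^+ d)%g x = x /\ weight d x = 1) <-> (4 * N %| d)%N.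
Proof.
move=> pN /dvdnP [a ->].
have N0 : (0 < N)%N.
  case: N pN => // /esym/eqP; by rewrite perm1 (negPf (rev_ord_neq x)).
have p2 : (p ^+ (2 * N))%g x = x by rewrite (revX 2 pN).
have w2 : weight (2 * N) x = -1.
  by rewrite mul2n -addnn weightD pN weight_rev pN sgn_rev mulrN sgnM.
(* Both sides fail for odd [a]. For even [a] the weight is -1 to the power [a./2], and -1 differs
   from 1 in characteristic zero. *)
rewrite dvdn_pmul2r // (revX a pN); case: (boolP (odd a)) => oa.
  split=> [[/eqP]|/dvdnP [b E]]; first by rewrite (negPf (rev_ord_neq x)).
  by move: oa; rewrite E oddM andbF.
have -> : a = (a./2 * 2)%N by rewrite muln2 halfK (negPf oa) subn0.
rewrite -mulnA (weight_cycle _ p2) w2 -signr_odd (@dvdn_pmul2r 2 2) // dvdn2.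
case: (odd a./2); rewrite ?expr1 ?expr0; split=> // -[_ /eqP].
by rewrite eq_sym -subr_eq0 opprK -mulr2n (pcharf0P _).1.
Qed.

(** Over a cycle of length N a power is trivial exactly when 4N divides the exponent; all cycles
    together give 4 times the lcm. *)
Lemma mono_has_order : (1 <= n)%N ->
  (forall X, X \in porbits s -> \prod_(i in X) eps i = -1) ->
  has_order (mono p w) (4 * \big[lcmn/1]_(X in porbits s) #|X|)%N.
Proof.
move=> n_ge1 prodN1; set L := \big[lcmn/1]_(X in porbits s) #|X|.
have revN j : (p ^+ #|porbit s j|)%g (lshift n j) = rev_ord (lshift n j).
  by rewrite lshiftX_porbit prodN1 // imset_f.
have dvdL d : (L %| d)%N <-> forall j, (#|porbit s j| %| d)%N.
  split=> [/dvdn_biglcmP H j|H]; first by apply: H; rewrite imset_f.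
  by apply/dvdn_biglcmP => _ /imsetP [j _ ->].
have order_dvd d : mono p w ^+ d = 1 <-> (4 * L %| d)%N.
  rewrite mono_exp_eq1; split=> [fixd|dvd4L x].
    have dvd4 j : (4 * #|porbit s j| %| d)%N.
      apply/(fix_rev_orbit (revN j)); last exact: fixd.
      by apply/perm_fix_dvd_porbit/lshiftX_fix; left; apply: (fixd _).1.
    (* One cycle, available as [n] is positive, gives divisibility by 4; cancelling 4 leaves the
       criterion for the lcm. *)
    have /dvdnP [d' dE] : (4 %| d)%N.
      by apply: dvdn_trans (dvd4 (Ordinal n_ge1)); apply: dvdn_mulr.
    rewrite dE mulnC dvdn_pmul2r //; apply/dvdL => j.
    by rewrite -(@dvdn_pmul2l 4) // [(4 * d')%N]mulnC -dE.
  have [j revj] : exists j, (p ^+ #|porbit s j|)%g x = rev_ord x.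
    case: (split_ordP x) => j ->; first by exists j.
    exists (rev_ord j); rewrite -[j in rshift n j]rev_ordK -rev_lshift.
    by rewrite rev_equivariantX revN.
  have dvdj : (4 * #|porbit s j| %| d)%N.
    apply: dvdn_trans dvd4L; rewrite dvdn_pmul2l //.
    exact: ((dvdL L).1 (dvdnn L) j).
  by apply/(fix_rev_orbit revj) => //; apply: dvdn_trans dvdj; apply: dvdn_mull.
split; last 2 first.
- exact/order_dvd.
- move=> e /andP [e0 eL] /order_dvd /(dvdn_leq e0); lia.
rewrite muln_gt0 /= /L; elim/big_ind: _ => // [a b a0 b0|_ /imsetP [j _ ->]].
  by rewrite lcmn_gt0 a0.
by apply/card_gt0P; exists j; apply: porbit_id.
Qed.

End MonomialOrder.

(* Rescaling one weight on an orbit through x but not rev x gives the orbit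
   weight 2, which is not a root of unity. *)
Lemma mono_class_infinite_order (k : fieldType) (n : nat) (p : 'S_(n + n))
    (s : 'S_n) (eps : 'I_n -> int) (w : 'I_(n + n) -> k) (j : 'I_n) :
  [pchar k] =i pred0 -> rev_equivariant p ->
  (forall i, eps i = 1 \/ eps i = -1) ->
  (forall i, p (lshift n i) =
     if eps i == 1 then lshift n (s i) else rev_ord (lshift n (s i))) ->
  symp_weight p w -> \prod_(i in porbit s j) eps i = 1 ->
  exists2 g : 'M[k]_(n + n), mono_class p g & ~ finite_order g.
Proof.
move=> char0 rp eps_sign pE sw prod1.
set x := lshift n j; set N := #|porbit s j|.
have pN : (p ^+ N)%g x = x by rewrite (lshiftX_porbit rp eps_sign pE) prod1 eqxx.
have nzw i := symp_weight_neq0 i sw.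
have nzW : weight p w N x != 0 by apply/prodf_neq0 => q _.
have nz2 : (2%:R : k) != 0 by rewrite (pcharf0P _).1.
pose b := 2%:R / weight p w N x.
have nzb : b != 0 by rewrite mulf_neq0 ?invr_eq0.
(* The inverse factor at [rev_ord x] preserves the symplectic relation. *)
pose v i := if i == x then w i * b else if i == rev_ord x then w i / b else w i.
have sv : symp_weight p v.
  move=> i; rewrite -(sw i) /v (inj_eq rev_ord_inj) (canF_eq (@rev_ordK _)).
  have [->|_] := eqVneq i x.
    by rewrite eq_sym (negPf (rev_ord_neq x)); field.
  by have [_|_] := eqVneq i (rev_ord x); first by field.
have vN : weight p v N x = 2%:R.
  rewrite -[RHS](divfK nzW) -/b /weight.
  have : (0 < N)%N by apply/card_gt0P; exists j; apply: porbit_id.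
  case NE : N => [//|N'] _; rewrite !big_ord_recl expg0 perm1 {1}/v eqxx.
  rewrite [RHS]mulrA [b * w x]mulrC.
  congr (_ * _); apply: eq_bigr => q _; rewrite /v.
  (* Meeting [x] or its reversal before [N] steps would bring [j] back too early in its cycle; hence
     only the first factor is rescaled. *)
  have sym_neq : ~ ((p ^+ lift ord0 q)%g x = x \/ (p ^+ lift ord0 q)%g x = rev_ord x).
    move=> /(lshiftX_fix rp eps_sign pE) /perm_fix_dvd_porbit.
    by rewrite -/N NE => /dvdn_leq => /(_ isT); rewrite /= /bump /=; have := ltn_ord q; lia.
  case: eqP => [E|_]; first by case: sym_neq; left.
  by case: eqP => // E; case: sym_neq; right.
exists (mono p v); first by exists v.
move=> [d d0 gd1].
have /mono_exp_eq1 /(_ x) [_] : mono p v ^+ (d * N) = 1.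
  by rewrite exprM gd1 expr1n.
rewrite (weight_cycle v d pN) vN -(expr0 2%:R) => /(pchar0_expr2_inj char0) E.
by rewrite E in d0.
Qed.

Theorem mainTheorem11 (k : closedFieldType) (char0 : [pchar k] =i pred0)
    (n : nat) (n_ge1 : (1 <= n)%N)
    (sigma : 'S_n) (eps : 'I_n -> int)
    (eps_sign : forall i, eps i = 1 \/ eps i = -1)
    (C : 'M[k]_(n + n) -> Prop)
    (C_comp : connected_component (torus_normalizer k n) C)
    (C_pair : corresponds C sigma eps) :
  (periodic C <->
     (forall X : {set 'I_n}, X \in porbits sigma -> \prod_(i in X) eps i = -1))
  /\ (periodic C -> forall g, C g ->
        has_order g (4 * \big[lcmn/1]_(X in porbits sigma) #|X|)%N).
Proof.
have [g0 Cg0 act] := C_pair.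
have [p [w [rp sw g0E CE]]] := connected_component_mono char0 C_comp Cg0.
rewrite g0E in act.
have pE := char_act_mono char0 eps_sign (fun i => symp_weight_neq0 i sw) act.
(* The permutation [p] is common to all of [C], so the order computation applies to each element
   with its own weights. *)
have ord : (forall X, X \in porbits sigma -> \prod_(i in X) eps i = -1) ->
    forall g, C g -> has_order g (4 * \big[lcmn/1]_(X in porbits sigma) #|X|)%N.
  by move=> prodN1 _ /CE [v sv ->]; apply: mono_has_order pE _ sv _ _.
have per : periodic C ->
    forall X, X \in porbits sigma -> \prod_(i in X) eps i = -1.
  move=> perC _ /imsetP [j _ ->].
  (* The only other value, 1, would put an element of infinite order into [C]. *)
  case: (prod_sign eps_sign (index_enum 'I_n) (mem (porbit sigma j)) id) => // prod1.
  have [g pg []] := mono_class_infinite_order char0 rp eps_sign pE sw prod1.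
  exact/perC/CE.
split; last by move=> /per; apply: ord.
split=> [//|/ord H g /H [d0 gd _]].
by exists (4 * \big[lcmn/1]_(X in porbits sigma) #|X|)%N.
Qed.
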